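(* Let $\phi : M^n \rightarrow \mathbb{R}^m$ be a homothetic soliton for the inverse mean curvature flow with constant velocity $a$. If $M$ is closed, then $a=1/n$ (i.e. $\phi$ is an expander for the inverse mean curvature flow) and $\phi$ must be a spherical minimal immersion, that is, $M$ is a minimal submanifold in some $(m-1)$-sphere of $\mathbb{R}^m$ centered at the origin.
   Context: Let $\phi : M^n \to \mathbb{R}^m$ be an isometric immersion of an $n$-dimensional manifold in Euclidean $m$-space, with second fundamental form $\sigma$ and nonvanishing mean curvature vector $H=\mathrm{trace}\,\sigma$ (not divided by $n$). $\phi$ is called a homothetic soliton for the inverse mean curvature flow with constant velocity $a$ if $a\neq 0$ is a real constant such that $-\frac{H}{|H|^2}=a\,\phi^\bot$, where $\phi^\bot$ is the projection of the position vector $\phi$ onto the normal bundle of $M$. It is called an expander if $a>0$ and a shrinker if $a<0$. Closed means compact without boundary.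
   Formalization: M is assumed connected (and nonempty); otherwise two concentric n-spheres of different radii in R^{n+1} form a closed homothetic soliton with a = 1/n that lies in no single sphere centered at the origin. *)

(* Defs.v *)
From HB Require Import structures.
From mathcomp Require Import all_boot all_order all_algebra.
From mathcomp Require Import all_classical all_reals all_analysis.

Set Implicit Arguments.
Unset Strict Implicit.
Unset Printing Implicit Defensive.

Import Order.TTheory GRing.Theory Num.Theory.
Import numFieldNormedType.Exports.

Local Open Scope classical_set_scope.
Local Open Scope ring_scope.

Section Euclidean.
Variables (R : realType) (m : nat).
Implicit Types (u v : 'rV[R]_m).

(* The library norm `|u| on row vectors is the sup norm; it gives the usual
   topology of R^m, but lengths and angles have to use the following. *)
Definition dot u v : R := (u *m v^T) 0 0.
Definition enorm u : R := Num.sqrt (dot u u).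

(* Subspaces of R^m are row spaces of matrices: u *m A^T = 0 says that u is
   orthogonal to every row of A. *)
Definition orthc p (A : 'M[R]_(p, m)) : 'M[R]_m := kermx A^T.

Definition orth_proj p (A : 'M[R]_(p, m)) v : 'rV[R]_m :=
  v *m proj_mx <<A>>%MS (orthc A).

Definition sphere (r : R) : set 'rV[R]_m := [set y | enorm y = r].

End Euclidean.

Fixpoint Ck (R : realType) (V W : normedModType R) (k : nat) (U : set V)
    (f : V -> W) : Prop :=
  if k is k'.+1 then
    (forall x, U x -> differentiable f x) /\ (forall v, Ck k' U ('D_v f))
  else {in U, continuous f}.

(* Only used for open U, so that values of f outside U play no role. *)
Definition smooth_on (R : realType) (V W : normedModType R) (U : set V)
  (f : V -> W) : Prop := forall k, Ck k U f.

Section Manifold.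
Variables (R : realType) (n : nat) (M : topologicalType).

(* A homeomorphism between an open subset of M and an open subset of R^n,
   given by total functions whose values elsewhere are irrelevant. *)
Record chart := Chart {
  cdom : set M;
  ccod : set 'rV[R]_n;
  cfwd : M -> 'rV[R]_n;
  cinv : 'rV[R]_n -> M;
  cdom_open : open cdom;
  ccod_open : open ccod;
  cfwd_cod : forall p, cdom p -> ccod (cfwd p);
  cinv_dom : forall x, ccod x -> cdom (cinv x);
  cfwdK : forall p, cdom p -> cinv (cfwd p) = p;
  cinvK : forall x, ccod x -> cfwd (cinv x) = x;
  cfwd_continuous : {in cdom, continuous cfwd};
  cinv_continuous : {in ccod, continuous cinv} }.

Definition transition (c c' : chart) : 'rV[R]_n -> 'rV[R]_n :=
  cfwd c' \o cinv c.

Definition transition_dom (c c' : chart) : set 'rV[R]_n :=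
  ccod c `&` [set x | cdom c' (cinv c x)].

(* Charts take values in open subsets of R^n, not of a half-space: these
   manifolds have no boundary. *)
Record smooth_manifold := SmoothManifold {
  atlas : set chart;
  manifold_hausdorff : hausdorff_space M;
  manifold_second_countable : @second_countable M;
  atlas_cover : forall p, exists2 c, atlas c & cdom c p;
  atlas_smooth : forall c c', atlas c -> atlas c' ->
    smooth_on (transition_dom c c') (transition c c') }.

Definition bilin (G : 'M[R]_n) (u v : 'rV[R]_n) : R := (u *m G *m v^T) 0 0.

(* metric c x is the Gram matrix (g_ij) of the metric at the point with
   coordinates x in the chart c. *)
Record riemannian_metric (S : smooth_manifold) := RiemannianMetric {
  metric :> chart -> 'rV[R]_n -> 'M[R]_n;
  metric_smooth : forall c, atlas S c -> smooth_on (ccod c) (metric c);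
  metric_sym : forall c x, atlas S c -> ccod c x -> (metric c x)^T = metric c x;
  metric_pos : forall c x u, atlas S c -> ccod c x -> u != 0 ->
    0 < bilin (metric c x) u u;
  metric_transition : forall c c' x u v, atlas S c -> atlas S c' ->
    transition_dom c c' x ->
    bilin (metric c x) u v =
    bilin (metric c' (transition c c' x))
          ('d (transition c c') x u) ('d (transition c c') x v) }.

End Manifold.

Section Immersion.
Variables (R : realType) (n m : nat) (M : topologicalType).
Variables (S : smooth_manifold R n M) (g : riemannian_metric S).
Variable phi : M -> 'rV[R]_m.

Definition localrep (c : chart R n M) : 'rV[R]_n -> 'rV[R]_m := phi \o cinv c.

Definition smooth_map : Prop :=
  forall c, atlas S c -> smooth_on (ccod c) (localrep c).

Definition immersion : Prop :=
  smooth_map /\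
  forall c x, atlas S c -> ccod c x -> injective ('d (localrep c) x).

Definition isometric_immersion : Prop :=
  immersion /\
  forall c x u v, atlas S c -> ccod c x ->
    bilin (g c x) u v = dot ('d (localrep c) x u) ('d (localrep c) x v).

(* The rows of the Jacobian matrix span the tangent space of M. *)
Definition tangent_space (c : chart R n M) (x : 'rV[R]_n) : 'M[R]_(n, m) :=
  jacobian (localrep c) x.

Definition normal_part (c : chart R n M) (x : 'rV[R]_n) (w : 'rV[R]_m) :=
  orth_proj (orthc (tangent_space c x)) w.

(* sigma(u, v) is the normal component of the Euclidean derivative of the
   field dphi(v) in the direction u; v is extended to a neighbourhood as a
   field with constant coordinates in the chart. *)
Definition second_fundamental_form (c : chart R n M) (x u v : 'rV[R]_n) :=
  normal_part c x ('D_u (fun y => 'D_v (localrep c) y) x).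

(* The trace g^ij B(e_i, e_j) of a vector-valued bilinear form. *)
Definition metric_trace (c : chart R n M) (x : 'rV[R]_n)
    (B : 'rV[R]_n -> 'rV[R]_n -> 'rV[R]_m) : 'rV[R]_m :=
  \sum_(i < n) \sum_(j < n)
    (invmx (g c x)) i j *: B (delta_mx 0 i) (delta_mx 0 j).

Definition mean_curvature (c : chart R n M) (x : 'rV[R]_n) : 'rV[R]_m :=
  metric_trace c x (second_fundamental_form c x).

Definition imcf_soliton (a : R) : Prop :=
  [/\ isometric_immersion,
      a != 0,
      forall c x, atlas S c -> ccod c x -> mean_curvature c x != 0
    & forall c x, atlas S c -> ccod c x ->
        - ((enorm (mean_curvature c x) ^+ 2)^-1 *: mean_curvature c x)
        = a *: normal_part c x (localrep c x)].

Definition imcf_expander (a : R) : Prop := imcf_soliton a /\ 0 < a.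

(* The Levi-Civita connection of a sphere centered at the origin is the
   Euclidean derivative followed by the projection onto the tangent space of
   the sphere, which at y is the orthogonal complement of y. *)
Definition sphere_derivative (c : chart R n M) (x u v : 'rV[R]_n) :=
  orth_proj (orthc (localrep c x)) ('D_u (fun y => 'D_v (localrep c) y) x).

(* For an immersion into such a sphere, the normal part of a vector tangent to
   the sphere is its component in the normal bundle of M in the sphere. *)
Definition sphere_second_fundamental_form
    (c : chart R n M) (x u v : 'rV[R]_n) :=
  normal_part c x (sphere_derivative c x u v).

Definition sphere_mean_curvature (c : chart R n M) (x : 'rV[R]_n) :=
  metric_trace c x (sphere_second_fundamental_form c x).

Definition minimal_in_sphere (r : R) : Prop :=
  [/\ isometric_immersion,
      forall p, sphere r (phi p)
    & forall c x, atlas S c -> ccod c x -> sphere_mean_curvature c x = 0].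

End Immersion.

(* Main.v *)
(* With f = |phi|^2, the soliton equation gives <H, phi> = -1/a and hence
   Delta f = 2 (n + <H, phi>) = 2 (n - 1/a).  Delta f is nonpositive at a
   maximum of f and nonnegative at a minimum, so compactness forces a = 1/n
   and f is harmonic.  By Hopf's strong maximum principle in charts, f is constant on
   the connected manifold M.  The position vector is then normal to M, the
   soliton equation makes H a multiple of it, and the component of H tangent to
   the sphere vanishes. *)
From HB Require Import structures.
Require Import Defs.
From mathcomp Require Import all_boot all_order all_algebra.
From mathcomp Require Import all_classical all_reals all_analysis.
From mathcomp Require Import lra ring.
Import Order.TTheory GRing.Theory Num.Theory.
Import numFieldNormedType.Exports.
Local Open Scope classical_set_scope.
Local Open Scope ring_scope.
Set Implicit Arguments.
Unset Strict Implicit.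

(** * Euclidean linear algebra *)

(** No Laplace operator on M is ever introduced. In a chart, row k of [frame] is the gradient of the
    k-th coordinate of phi, and frozen second derivatives along these m vectors, minus one first
    derivative along [drift], act on |phi|^2 as the Laplacian would. Using the m gradients avoids
    choosing an orthonormal frame of the n-dimensional tangent space: they are continuous by their
    explicit formula, and they span because their Gram sum is the inverse metric. These two
    properties are what Hopf's argument asks of its directions. The derivative tests at an extremum
    read off only the sign of the constant n - 1/a; they say nothing about f elsewhere. This is why
    a strong maximum principle has to follow. Its usual exponential barrier is replaced by a
    quadratic polynomial, whose first and second derivatives are explicit. *)

Section Dot.
Variables (R : realType) (m : nat).
Implicit Types (u v w : 'rV[R]_m).

Lemma dotE u v : dot u v = \sum_i u 0 i * v 0 i.
Proof. by rewrite /dot mxE; apply: eq_bigr => i _; rewrite mxE. Qed.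

Lemma dotC u v : dot u v = dot v u.
Proof. by rewrite !dotE; apply: eq_bigr => i _; rewrite mulrC. Qed.

Lemma dotDl u v w : dot (u + v) w = dot u w + dot v w.
Proof. by rewrite /dot mulmxDl mxE. Qed.

Lemma dotDr u v w : dot u (v + w) = dot u v + dot u w.
Proof. by rewrite dotC dotDl !(dotC u). Qed.

Lemma dotZl (c : R) u v : dot (c *: u) v = c * dot u v.
Proof. by rewrite /dot -scalemxAl mxE. Qed.

Lemma dotZr (c : R) u v : dot u (c *: v) = c * dot u v.
Proof. by rewrite dotC dotZl dotC. Qed.

Lemma dotNl u v : dot (- u) v = - dot u v.
Proof. by rewrite -scaleN1r dotZl mulN1r. Qed.

Lemma dotNr u v : dot u (- v) = - dot u v.
Proof. by rewrite dotC dotNl dotC. Qed.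

Lemma dot0l u : dot 0 u = 0.
Proof. by rewrite /dot mul0mx mxE. Qed.

Lemma dot_suml (I : finType) (F : I -> 'rV[R]_m) u :
  dot (\sum_i F i) u = \sum_i dot (F i) u.
Proof. by rewrite /dot mulmx_suml summxE. Qed.

Lemma dot_mulmxl p (u : 'rV[R]_p) (A : 'M[R]_(p, m)) v :
  dot (u *m A) v = dot u (v *m A^T).
Proof. by rewrite /dot trmx_mul trmxK mulmxA. Qed.

Lemma dot_delta i u : dot (delta_mx 0 i) u = u 0 i.
Proof. by rewrite /dot -rowE !mxE. Qed.

Lemma dot_ge0 u : 0 <= dot u u.
Proof. by rewrite dotE sumr_ge0 // => i _; rewrite -expr2 sqr_ge0. Qed.

Lemma dot_eq0 u : (dot u u == 0) = (u == 0).
Proof.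
apply/idP/eqP => [|->]; last by rewrite dot0l.
rewrite dotE psumr_eq0 => [/allP u0|i _]; last by rewrite -expr2 sqr_ge0.
apply/rowP => i; rewrite mxE; have := u0 i (mem_index_enum i).
by rewrite /= mulf_eq0 orbb => /eqP.
Qed.

Lemma dot_gt0 u : (0 < dot u u) = (u != 0).
Proof. by rewrite lt_def dot_ge0 andbT dot_eq0. Qed.

Lemma sqr_enorm u : enorm u ^+ 2 = dot u u.
Proof. by rewrite sqr_sqrtr ?dot_ge0. Qed.

Lemma dot_sqrB u v : dot (u - v) (u - v) = dot u u - 2 * dot v u + dot v v.
Proof. by rewrite !(dotDl, dotDr, dotNl, dotNr) (dotC u v); ring. Qed.

Lemma dot_parallelogram u v :
  dot (u + v) (u + v) <= 2 * (dot u u + dot v v).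
Proof.
have := dot_ge0 (u - v).
rewrite !(dotDl, dotDr, dotNl, dotNr) (dotC v u); lra.
Qed.

(** This links the sup norm, which carries the topology, to Euclidean length: it puts a Euclidean
    ball inside each neighbourhood and makes Euclidean balls bounded. *)
Lemma sqr_normr_le_dot u : `|u| ^+ 2 <= dot u u.
Proof.
have coord i : u 0 i ^+ 2 <= dot u u.
  rewrite dotE (bigD1 i) //= expr2 lerDl sumr_ge0 // => j _.
  by rewrite -expr2 sqr_ge0.
rewrite -ler_sqrt ?dot_ge0 // sqrtr_sqr ger0_norm //.
rewrite [leLHS]/Num.Def.normr /= mx_normrE.
apply: bigmax_le => [|[i j] _]; first exact: sqrtr_ge0.
by rewrite /= ord1 -sqrtr_sqr ler_sqrt ?dot_ge0.
Qed.

Lemma dot_row_mul_tr p (A : 'M[R]_(p, m)) :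
  \sum_i dot (row i A) (row i A) = \tr (A *m A^T).
Proof.
rewrite /mxtrace; apply: eq_bigr => i _; rewrite dotE mxE.
by apply: eq_bigr => j _; rewrite !mxE.
Qed.

End Dot.

Section OrthogonalProjection.
Variables (R : realType) (m : nat).

Lemma sub_orthc p q (A : 'M[R]_(p, m)) (B : 'M[R]_(q, m)) :
  (B <= orthc A)%MS = (B *m A^T == 0).
Proof. exact: sub_kermx. Qed.

(** If u = d A and u A^T = 0, then <u, u> = <d, u A^T> = 0, and positivity of [dot] gives u = 0. *)
Lemma cap_orthc p (A : 'M[R]_(p, m)) : (A :&: orthc A)%MS = 0.
Proof.
apply/eqP; rewrite -submx0; apply/row_subP => i.
set u := row i _.
have /submxP[d ud] : (u <= A)%MS by rewrite (submx_trans (row_sub _ _)) ?capmxSl.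
have uA : u *m A^T = 0.
  apply/eqP; rewrite -sub_orthc.
  by rewrite (submx_trans (row_sub _ _)) ?capmxSr.
by rewrite submx0 -dot_eq0 {1}ud dot_mulmxl uA dotC dot0l.
Qed.

Lemma rank_orthc p (A : 'M[R]_(p, m)) : \rank (orthc A) = (m - \rank A)%N.
Proof. by rewrite mxrank_ker mxrank_tr. Qed.

Lemma adds_orthc p (A : 'M[R]_(p, m)) : row_full (A + orthc A)%MS.
Proof.
have := mxrank_sum_cap A (orthc A).
by rewrite cap_orthc mxrank0 addn0 rank_orthc subnKC ?rank_leq_col // => /eqP.
Qed.

(** The inclusion of A in its double complement is immediate; equality follows by counting
    dimensions. *)
Lemma orthcK p (A : 'M[R]_(p, m)) : (orthc (orthc A) :=: A)%MS.
Proof.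
apply/eqmx_sym/eqmxP; rewrite -(mxrank_leqif_eq _).
  by rewrite !rank_orthc subKn ?rank_leq_col.
rewrite sub_orthc -[A in A *m _]trmxK -trmx_mul -[eqbRHS]trmx0.
by rewrite (inj_eq (can_inj (@trmxK _ _ _))) mulmx_ker.
Qed.

Lemma orth_proj_sub p (A : 'M[R]_(p, m)) v : (orth_proj A v <= A)%MS.
Proof. by rewrite (submx_trans (proj_mx_sub _ _ _)) ?genmxE. Qed.

Lemma sub_orth_proj p (A : 'M[R]_(p, m)) v :
  (v - orth_proj A v <= orthc A)%MS.
Proof.
apply: proj_mx_compl_sub; rewrite submx_full //.
rewrite /row_full (adds_eqmx (genmxE A) (eqmx_refl (orthc A))).
exact: adds_orthc.
Qed.

Lemma orth_proj_linear p (A : 'M[R]_(p, m)) : linear (orth_proj A).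
Proof. by move=> c u v; rewrite /orth_proj mulmxDl scalemxAl. Qed.

HB.instance Definition _ p (A : 'M[R]_(p, m)) :=
  GRing.isLinear.Build R 'rV[R]_m 'rV[R]_m _ (orth_proj A) (orth_proj_linear A).

(** Both sides equal the product of the two projections, the remainders being orthogonal to the row
    space of A. *)
Lemma dot_orth_proj p (A : 'M[R]_(p, m)) u v :
  dot (orth_proj A u) v = dot u (orth_proj A v).
Proof.
have orth (x y : 'rV[R]_m) : (x <= A)%MS -> (y <= orthc A)%MS -> dot x y = 0.
  by move=> /submxP[d ->]; rewrite sub_orthc dot_mulmxl dotC => /eqP->; exact: dot0l.
transitivity (dot (orth_proj A u) (orth_proj A v)).
  rewrite -[v in LHS](subrK (orth_proj A v)) dotDr.
  by rewrite (orth _ _ (orth_proj_sub _ _)) ?add0r ?sub_orth_proj.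
rewrite -[u in RHS](subrK (orth_proj A u)) dotDl [dot (u - _) _]dotC.
by rewrite (orth _ (u - _) (orth_proj_sub _ _)) ?add0r ?sub_orth_proj.
Qed.

Lemma orth_proj_id p (A : 'M[R]_(p, m)) v : (v <= A)%MS -> orth_proj A v = v.
Proof.
move=> vA; apply: proj_mx_id; last by rewrite genmxE.
apply/eqP; rewrite -mxrank_eq0 (cap_eqmx (genmxE A) (eqmx_refl (orthc A))).
by rewrite cap_orthc mxrank0.
Qed.

End OrthogonalProjection.

(** * Continuity and directional derivatives *)

Section MatrixContinuity.
Variables (R : realType) (T : topologicalType) (x : T).

Lemma continuous_mxP m n (f : T -> 'M[R]_(m, n)) :
  continuous_at x f <-> forall i j, continuous_at x (fun t => f t i j).
Proof.
split=> [fx i j|fx].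
  by apply: (cvg_comp f (fun B : 'M[R]_(m, n) => B i j) fx); exact: coord_continuous.
apply/cvgrPdist_le => e e0; near=> t.
rewrite [leLHS]/Num.Def.normr /= mx_normrE.
apply: bigmax_le (ltW e0) _ => -[i j] _; rewrite !mxE /=.
move: i j; near: t.
apply: filter_forall => i; apply: filter_forall => j.
exact: ((cvgrPdist_le _ _).1 (fx i j)).
Unshelve. all: by end_near. Qed.

Lemma near_eq_continuous_at (U : topologicalType) (f h : T -> U) :
  (\forall y \near x, f y = h y) -> continuous_at x f -> continuous_at x h.
Proof.
move=> fh; rewrite /continuous_at (nbhs_singleton fh).
by apply: cvg_trans; exact: near_eq_cvg.
Qed.

Lemma continuous_addr (f g : T -> R) :
  continuous_at x f -> continuous_at x g -> continuous_at x (fun t => f t + g t).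
Proof. exact: continuousD. Qed.

Lemma continuous_oppr (f : T -> R) :
  continuous_at x f -> continuous_at x (fun t => - f t).
Proof. exact: continuousN. Qed.

Lemma continuous_mulr (f g : T -> R) :
  continuous_at x f -> continuous_at x g -> continuous_at x (fun t => f t * g t).
Proof. exact: continuousM. Qed.

Lemma continuous_sumr (I : finType) (f : I -> T -> R) :
  (forall i, continuous_at x (f i)) ->
  continuous_at x (fun t => \sum_i f i t).
Proof. by move=> fx; apply: cvg_big => [|i _]; [exact: add_continuous | exact: fx]. Qed.

Lemma continuous_prodr (I : finType) (f : I -> T -> R) :
  (forall i, continuous_at x (f i)) ->
  continuous_at x (fun t => \prod_i f i t).
Proof. by move=> fx; apply: cvg_big => [|i _]; [exact: mul_continuous | exact: fx]. Qed.

Lemma continuous_trmx m n (f : T -> 'M[R]_(m, n)) :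
  continuous_at x f -> continuous_at x (fun t => (f t)^T).
Proof.
move=> /continuous_mxP fx; apply/continuous_mxP => i j.
by under eq_fun do rewrite mxE; exact: fx.
Qed.

Lemma continuous_mulmx m n p (f : T -> 'M[R]_(m, n)) (g : T -> 'M[R]_(n, p)) :
  continuous_at x f -> continuous_at x g ->
  continuous_at x (fun t => f t *m g t).
Proof.
move=> /continuous_mxP fx /continuous_mxP gx; apply/continuous_mxP => i j.
under eq_fun do rewrite mxE.
by apply: continuous_sumr => k; apply: continuous_mulr; [exact: fx | exact: gx].
Qed.

Lemma continuous_row m n (f : T -> 'M[R]_(m, n)) i :
  continuous_at x f -> continuous_at x (fun t => row i (f t)).
Proof.
move=> /continuous_mxP fx; apply/continuous_mxP => j k.
by under eq_fun do rewrite mxE; exact: fx.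
Qed.

Lemma continuous_det n (f : T -> 'M[R]_n) :
  continuous_at x f -> continuous_at x (fun t => \det (f t)).
Proof.
move=> /continuous_mxP fx; apply: continuous_sumr => s.
apply: continuous_mulr; first exact: cst_continuous.
by apply: continuous_prodr => i; exact: fx.
Qed.

Lemma continuous_invmx n (f : T -> 'M[R]_n) : f x \in unitmx ->
  continuous_at x f -> continuous_at x (fun t => invmx (f t)).
Proof.
move=> ux fx; have dx := continuous_det fx.
have dx0 : \det (f x) != 0 by rewrite -unitfE -unitmxE.
(* [invmx] agrees with the cofactor formula only on invertible matrices, so the two functions are
   compared near x, where the determinant stays nonzero. *)
apply: (near_eq_continuous_at (f := fun t => (\det (f t))^-1 *: \adj (f t))).
  near=> t; rewrite /invmx unitmxE unitfE ifT //; near: t.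
  exact: cvgr_neq0 dx0.
apply/continuous_mxP => i j; under eq_fun do rewrite mxE.
apply: continuous_mulr; first by apply: cvgV.
under eq_fun do rewrite mxE.
apply: continuous_mulr; first exact: cst_continuous.
apply: continuous_det; apply/continuous_mxP => k l.
under eq_fun do rewrite !mxE.
by move/continuous_mxP: fx; exact.
Unshelve. all: by end_near. Qed.

Lemma continuous_dot m (f g : T -> 'rV[R]_m) :
  continuous_at x f -> continuous_at x g ->
  continuous_at x (fun t => dot (f t) (g t)).
Proof.
move=> fx gx; have /continuous_mxP := continuous_mulmx fx (continuous_trmx gx).
exact.
Qed.

End MatrixContinuity.

Section DirectionalDerivatives.
Variable R : realType.

Lemma is_derive_line (V W : normedModType R) (F : V -> W) (x v : V) (t : R) d :
  is_derive (t *: v + x) v F d ->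
  is_derive t 1 (fun s : R => F (s *: v + x)) d.
Proof.
have E : (fun h : R => h^-1 *: (F ((h *: 1%R + t) *: v + x) - F (t *: v + x)))
    = (fun h => h^-1 *: (F (h *: v + (t *: v + x)) - F (t *: v + x))).
  by apply/funext => h; rewrite addrA -scalerDl [h *: 1]mulr1.
case=> dF <-; apply: DeriveDef; first by move: dF; rewrite /derivable /= -E.
by rewrite /derive /= -E.
Qed.

(** For the second-order part, suppose the second derivative is positive. Since the first derivative
    vanishes at x, it is then positive just after x on the line, so F increases strictly there,
    against the maximum. *)
Lemma derive2_at_max (V : normedModType R) (F : V -> R) (x v : V) :
  (\forall y \near x, derivable F y v) -> derivable ('D_v F) x v ->
  (\forall y \near x, F y <= F x) ->
  'D_v F x = 0 /\ 'D_v ('D_v F) x <= 0.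
Proof.
move=> dF d2F Fmax.
have line : (fun t : R => t *: v + x) @ (0 : R) --> x.
  rewrite -[X in _ --> X]add0r -(scale0r v).
  by apply: cvgD; [apply: cvgZl; exact: cvg_id | exact: cvg_cst].
have [d /= d0 Hd] : exists2 d : R, 0 < d & forall t, `|t| < d ->
    derivable F (t *: v + x) v /\ F (t *: v + x) <= F x.
  have /nbhs_ballP[d /= d0 Hd] : nbhs (0 : R)
      [set t : R | derivable F (t *: v + x) v /\ F (t *: v + x) <= F x].
    exact: line _ (filterI dF Fmax).
  by exists d => // t td; apply: Hd; rewrite /ball /= sub0r normrN.
set g := fun t : R => F (t *: v + x).
have dg (t : R) : `|t| < d -> is_derive t 1 g ('D_v F (t *: v + x)).
  by move=> /Hd[dFt _]; apply: is_derive_line; exact: derivableP.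
have DF0 : 'D_v F x = 0.
  have in0 : 0 \in `]- d, d[%R by rewrite in_itv /= d0 oppr_lt0 d0.
  have itv t : t \in `]- d, d[%R -> `|t| < d by rewrite in_itv /= ltr_norml.
  have [_ g0] : is_derive (0 : R) 1 g 0.
    apply: (@derive1_at_max R g (- d) d 0) => //.
    - by rewrite ltW // (lt_trans _ d0) ?oppr_lt0.
    - by move=> t /itv /dg[].
    - by move=> t /itv /Hd[_]; rewrite /g scale0r add0r.
  have [_] := dg 0 (itv _ in0).
  by rewrite g0 scale0r add0r.
split=> //; rewrite leNgt; apply/negP => D2.
have [e /= e0 He] : exists2 e : R, 0 < e &
    forall t, 0 < t -> t < e -> 0 < 'D_v F (t *: v + x).
  have : \forall t \near 0^', 0 < t^-1 *: ('D_v F (t *: v + x) - 'D_v F x).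
    by apply: (cvgr_gt ('D_v ('D_v F) x)) => //; exact: d2F.
  rewrite DF0 near_withinE => /nbhs_ballP[e /= e0 He].
  exists e => // t t0 te; have := He t.
  rewrite /ball /= sub0r normrN gtr0_norm // gt_eqF // => /(_ te isT).
  by rewrite subr0 pmulr_rgt0 ?invr_gt0.
set b := Num.min d e / 2.
have b0 : 0 < b by rewrite divr_gt0 // lt_min d0.
have bd : b < Num.min d e by rewrite /b; have : 0 < Num.min d e; [rewrite lt_min d0|lra].
have bd' : b < d by rewrite (lt_le_trans bd) ?ge_min ?lexx.
have be : b < e by rewrite (lt_le_trans bd) ?ge_min ?lexx ?orbT.
have gder (t : R) : 0 <= t -> t <= b -> is_derive t 1 g ('D_v F (t *: v + x)).
  by move=> t0 tb; apply: dg; rewrite ger0_norm // (le_lt_trans tb).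
have : g 0 < g b.
  apply: (@gtr0_derive1_incr R g 0 b) => //.
  - by move=> t; rewrite in_itv => /andP[t0 tb]; case: (gder t (ltW t0) (ltW tb)).
  - move=> t; rewrite in_itv => /andP[t0 tb].
    have [_] := gder t (ltW t0) (ltW tb); rewrite derive1E => ->.
    by apply: He => //; exact: lt_trans be.
  - apply: derivable_within_continuous => t; rewrite in_itv => /andP[t0 tb].
    by case: (gder t t0 tb).
rewrite /g scale0r add0r ltNge.
by have [|_ ->] := Hd b; rewrite ?ger0_norm ?ltW.
Qed.

Lemma derive2_at_min (V : normedModType R) (F : V -> R) (x v : V) :
  (\forall y \near x, derivable F y v) -> derivable ('D_v F) x v ->
  (\forall y \near x, F x <= F y) ->
  'D_v F x = 0 /\ 0 <= 'D_v ('D_v F) x.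
Proof.
move=> dF d2F Fmin; have dFx := nbhs_singleton dF.
have DN : \forall y \near x, (- 'D_v F) y = 'D_v (- F) y.
  by apply: filterS dF => y dFy; rewrite deriveN.
have [|||+ +] := @derive2_at_max _ (- F) x v.
- by apply: filterS dF => y; exact: derivableN.
- exact: near_eq_derivable DN (derivableN d2F).
- by apply: filterS Fmin => y; rewrite lerN2.
- rewrite deriveN // -(near_eq_derive _ DN) deriveN // oppr_le0.
  by move=> /eqP; rewrite oppr_eq0 => /eqP.
Qed.

Lemma differentiable_dot (V : normedModType R) m (f g : V -> 'rV[R]_m) x :
  differentiable f x -> differentiable g x ->
  differentiable (fun y => dot (f y) (g y)) x.
Proof.
have coord (h : V -> 'rV[R]_m) i :
    differentiable h x -> differentiable (fun y => h y 0 i) x.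
  move=> dh; apply: (@differentiable_comp _ _ _ _ h (fun M : 'rV[R]_m => M 0 i)) => //.
  exact: differentiable_coord.
move=> df dg; rewrite (_ : (fun _ => _) =
    \sum_(i < m) ((fun y => f y 0 i) * (fun y => g y 0 i))).
  by apply: differentiable_sum => i; apply: differentiableM; exact: coord.
by apply/funext => y; rewrite fct_sumE dotE.
Qed.

Lemma is_derive_addr (V : normedModType R) (f g : V -> R) x v df dg :
  is_derive x v f df -> is_derive x v g dg ->
  is_derive x v (fun y => f y + g y) (df + dg).
Proof. exact: is_deriveD. Qed.

Lemma is_derive_mulr (V : normedModType R) (f g : V -> R) x v df dg :
  is_derive x v f df -> is_derive x v g dg ->
  is_derive x v (fun y => f y * g y) (f x * dg + g x * df).
Proof. exact: is_deriveM. Qed.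

Lemma is_derive_coord (V : normedModType R) m n (f : V -> 'M[R]_(m, n)) x v df i j :
  is_derive x v f df -> is_derive x v (fun y => f y i j) (df i j).
Proof.
case=> df_ <-; apply: DeriveDef; first by move/derivable_mxP: df_.
by rewrite derive_mx // mxE.
Qed.

Lemma is_derive_dot (V : normedModType R) m (f g : V -> 'rV[R]_m) x v df dg :
  is_derive x v f df -> is_derive x v g dg ->
  is_derive x v (fun y => dot (f y) (g y)) (dot df (g x) + dot (f x) dg).
Proof.
move=> fx gx.
have -> : (fun y => dot (f y) (g y)) =
    \sum_(i < m) ((fun y => f y 0 i) * (fun y => g y 0 i)).
  by apply/funext => y; rewrite fct_sumE dotE.
apply: is_derive_eq.
  apply: is_derive_sum => i.
  by apply: is_deriveM; exact: is_derive_coord.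
rewrite !dotE -big_split; apply: eq_bigr => i _ /=.
by rewrite addrC /GRing.scale /= [g _ _ _ * _]mulrC.
Qed.

End DirectionalDerivatives.

(** * The strong maximum principle *)

Section EuclideanBalls.
Variables (R : realType) (n : nat).
Implicit Types (x z : 'rV[R]_n).

Lemma continuous_subr z : continuous (fun x => x - z).
Proof. by move=> x; apply: continuousB; [exact: cvg_id | exact: cst_continuous]. Qed.

Lemma continuous_dot_sub z : continuous (fun x => dot (x - z) (x - z)).
Proof. by move=> x; apply: continuous_dot; exact: continuous_subr. Qed.

(** Here, as for all balls below, [r] bounds the squared Euclidean distance, which keeps square
    roots away. Halving [e] turns the weak inequality into the strict one of the open ball. *)
Lemma nbhs_dot_le z (A : set 'rV[R]_n) : nbhs z A ->
  exists2 r, 0 < r & forall x, dot (x - z) (x - z) <= r -> A x.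
Proof.
move=> /nbhs_ballP[e /= e0 He]; exists ((e / 2) ^+ 2) => [|x xr].
  by rewrite exprn_gt0 ?divr_gt0.
apply: He; rewrite -ball_normE /= distrC.
have : `|x - z| ^+ 2 <= (e / 2) ^+ 2 := le_trans (sqr_normr_le_dot _) xr.
rewrite ler_pXn2r ?nnegrE ?normr_ge0 ?divr_ge0 ?(ltW e0) // => xz.
by apply: le_lt_trans xz _; lra.
Qed.

Lemma closed_dot_le z r : closed [set x | dot (x - z) (x - z) <= r].
Proof.
apply: (@preimage_closed _ _ (fun x => dot (x - z) (x - z)) [set t | t <= r]).
  by move=> x _; exact: continuous_dot_sub.
exact: closed_le.
Qed.

Lemma compact_dot_le z r : compact [set x | dot (x - z) (x - z) <= r].
Proof.
apply: bounded_closed_compact.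
  (* From t ^ 2 <= r follows t <= 1 + r. *)
  exists (`|z| + (1 + r)); split; first exact: num_real.
  move=> M ltM x /= xr; apply: ltW (le_lt_trans _ ltM).
  rewrite -[x in `|x|](subrK z) addrC (le_trans (ler_normD _ _)) //.
  rewrite lerD2l; have := le_trans (sqr_normr_le_dot _) xr.
  have := normr_ge0 (x - z); move: `|x - z| => t; nra.
exact: closed_dot_le.
Qed.

End EuclideanBalls.

Section StrongMaximumPrinciple.
Variables (R : realType) (n k : nat) (U : set 'rV[R]_n) (f : 'rV[R]_n -> R).
Variables (X : 'I_k -> 'rV[R]_n -> 'rV[R]_n) (Y : 'rV[R]_n -> 'rV[R]_n).
Hypothesis U_open : open U.
Hypothesis f_diff : forall x, U x -> differentiable f x.
Hypothesis f_diff2 : forall x v, U x -> derivable ('D_v f) x v.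
Hypothesis X_cont : forall i x, U x -> continuous_at x (X i).
Hypothesis Y_cont : forall x, U x -> continuous_at x Y.
Hypothesis X_elliptic : forall x u, U x -> (forall i, dot u (X i x) = 0) -> u = 0.
(** The direction [X i x] is frozen while both derivatives are taken, so no derivative of X i
    enters; the second order coefficients are the entries of sum_i X_i^T X_i. *)
Hypothesis f_subsol : forall x, U x ->
  'D_(Y x) f x <= \sum_i 'D_(X i x) ('D_(X i x) f) x.

(* Hopf's argument, with L = sum_i D_(X_i) D_(X_i) - D_Y. With w = x - z and
   s = <y - z, w>, the ball is |w|^2 < 2 s, so near z the quadratic barrier
   h = s (1 + C s) - |w|^2 is nonnegative only inside the ball or at z, while
   Lh > 0 for C large. Then f + eps h attains an interior maximum near z, where
   L (f + eps h) should be nonpositive. *)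
Lemma hopf_touching_ball (z y : 'rV[R]_n) : U z -> y != z ->
  (forall x, U x -> f x <= f z) ->
  ~ (forall x, U x -> dot (x - y) (x - y) < dot (z - y) (z - y) -> f x < f z).
Proof.
move=> Uz yz fmax finball.
pose nu : 'rV[R]_n := y - z; pose s (x : 'rV[R]_n) := dot nu (x - z).
pose q (x : 'rV[R]_n) := dot (x - z) (x - z).
pose E x := \sum_i dot nu (X i x) ^+ 2.
pose T x := \sum_i dot (X i x) (X i x).
(* Ellipticity enters here: if E z vanished, y - z would be orthogonal to every X i z. *)
have Ez : 0 < E z.
  rewrite lt_def sumr_ge0 ?andbT => [|i _]; last exact: sqr_ge0.
  apply: contra_neq yz => /eqP.
  rewrite psumr_eq0 => [/allP Xz|i _]; last exact: sqr_ge0.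
  apply/eqP; rewrite -subr_eq0; apply/eqP/(X_elliptic Uz) => i.
  by have := Xz i (mem_index_enum i); rewrite sqrf_eq0 => /eqP.
(* This makes 2 C E z exceed 2 T z + <nu, Y z>, which is positivity of L z. *)
pose C := (1 + `|2 * T z + dot nu (Y z)|) / E z.
have C0 : 0 < C by rewrite divr_gt0 // ltr_pwDl.
(* This is the operator applied to the barrier h introduced below, written out. *)
pose L x := 2 * C * E x - 2 * T x -
  (dot nu (Y x) * (1 + 2 * C * s x) - 2 * dot (x - z) (Y x)).
have sz : s z = 0 by rewrite /s subrr dotC dot0l.
have Lz : 0 < L z.
  rewrite /L sz subrr dot0l -mulrA /C divfK ?gt_eqF //.
  have := ler_norm (2 * T z + dot nu (Y z)); have := normr_ge0 (2 * T z + dot nu (Y z)).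
  by move: `|_| => t; lra.
have s_cont : continuous s.
  by move=> x; apply: continuous_dot; [exact: cst_continuous | exact: continuous_subr].
have q_cont : continuous q by exact: continuous_dot_sub.
have L_cont : continuous_at z L.
  have cX i : continuous_at z (X i) by exact: X_cont.
  have cY : continuous_at z Y by exact: Y_cont.
  have cc (V : normedModType R) (w : V) : continuous_at z (fun=> w) by exact: cst_continuous.
  have c1 : continuous_at z (fun x => 2 * C * E x).
    apply: continuous_mulr; first exact: cc.
    apply: continuous_sumr => i.
    by apply: continuous_mulr; exact: continuous_dot (cc _ nu) (cX i).
  have c2 : continuous_at z (fun x => 2 * T x).
    apply: continuous_mulr; first exact: cc.
    by apply: continuous_sumr => i; exact: continuous_dot (cX i) (cX i).
  have c3 : continuous_at z (fun x => dot nu (Y x) * (1 + 2 * C * s x)).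
    apply: continuous_mulr; first exact: continuous_dot (cc _ nu) cY.
    apply: continuous_addr; first exact: cc.
    by apply: continuous_mulr; [exact: cc | exact: s_cont].
  have c4 : continuous_at z (fun x => 2 * dot (x - z) (Y x)).
    apply: continuous_mulr; first exact: cc.
    exact: continuous_dot (@continuous_subr _ _ z z) cY.
  apply: continuous_addr; first by apply: continuous_addr => //; exact: continuous_oppr.
  by apply: continuous_oppr; apply: continuous_addr => //; exact: continuous_oppr.
have [r r0 Hr] : exists2 r, 0 < r & forall x, q x <= r ->
    [/\ U x, 0 < L x & `|C * s x| < 1 / 2].
  suff /nbhs_dot_le[r r0 Hr] : nbhs z [set x | [/\ U x, 0 < L x & `|C * s x| < 1 / 2]].
    by exists r.
  have nU : nbhs z U by exact: open_nbhs_nbhs.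
  have nL : \forall x \near z, 0 < L x by exact: (cvgr_gt (L z) L_cont).
  have ns : \forall x \near z, `|C * s x| < 1 / 2.
    have Cs_cont : continuous_at z (fun x => C * s x).
      by apply: continuous_mulr; [exact: cst_continuous | exact: s_cont].
    by apply: (cvgr_norm_lt (C * s z) Cs_cont); rewrite sz mulr0 normr0.
  by near=> x; split; near: x.
pose h (x : 'rV[R]_n) : R := s x * (1 + C * s x) - q x.
have h_cont : continuous h.
  have hx (x : 'rV[R]_n) c : continuous_at x (fun=> c : R) by exact: cst_continuous.
  move=> x; apply: continuous_addr; last by apply: continuous_oppr; exact: q_cont.
  apply: continuous_mulr; first exact: s_cont.
  apply: continuous_addr; first exact: hx.
  by apply: continuous_mulr; [exact: hx | exact: s_cont].
(* Since |C s| < 1/2, the factor 1 + C s lies between 1/2 and 3/2. So h >= 0 and q > 0 force s > 0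
   and q <= 3/2 s < 2 s, which places x in the open ball. *)
have inball x : q x <= r -> 0 <= h x -> x != z -> f x < f z.
  move=> xr hx xz; have [Ux _ Csx] := Hr _ xr.
  apply: finball => //.
  have -> : x - y = (x - z) - nu by rewrite /nu opprB addrA subrK.
  have -> : z - y = - nu by rewrite opprB.
  rewrite dot_sqrB dotNl dotNr opprK -/(s x) -/(q x).
  have qx : 0 < q x by rewrite dot_gt0 subr_eq0.
  move: hx Csx; rewrite /h ltr_norml => hx /andP[Cs1 Cs2].
  have s0 : 0 < s x by nra.
  nra.
(* C h is at most C s (1 + C s) <= 1/2 * 3/2. *)
have h_le x : q x <= r -> h x <= 3 / 4 / C.
  move=> xr; have [_ _] := Hr _ xr; rewrite ltr_norml => /andP[Cs1 Cs2].
  rewrite ler_pdivlMr // /h; have := dot_ge0 (x - z); rewrite -/(q x) => qx.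
  have : C * q x >= 0 by rewrite mulr_ge0 // ltW.
  nra.
have f_cont x : U x -> {for x, continuous f}.
  by move=> /f_diff; exact: differentiable_continuous.
have z_notin x : q x = r -> x != z.
  by apply: contra_eq_neq => ->; rewrite /q subrr dot0l lt_eqF.
(* The part of the sphere q = r where h >= 0 is compact and misses z, so f stays below f z there by
   a uniform gap d. *)
have [d d0 Hd] : exists2 d, 0 < d & forall x, q x = r -> 0 <= h x -> f x <= f z - d.
  pose S := [set x | q x = r] `&` [set x | 0 <= h x].
  have [S0|/set0P/negP] := pselect (S !=set0); last first.
    rewrite negbK => /eqP S0; exists 1 => // x qx hx.
    by have : S x by []; rewrite S0.
  have cS : compact S.
    apply: subclosed_compact (compact_dot_le (z := z) (r := r)) _.
      by apply: closedI; [apply: (@preimage_closed _ _ q [set t | t = r]) => [x _|] |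
        apply: (@preimage_closed _ _ h [set t | 0 <= t]) => [x _|]];
        [exact: q_cont | exact: closed_eq | exact: h_cont | exact: closed_ge].
    by move=> x [/= qx _]; rewrite -/(q x) qx.
  have [|c /set_mem[/= qc hc] cmax] := EVT_max_rV (f := f) S0 cS.
    apply: continuous_in_subspaceT => x /set_mem[/= qx _].
    by apply: f_cont; have [] := Hr x; rewrite ?qx.
  exists (f z - f c); first by rewrite subr_gt0 inball ?qc // z_notin.
  move=> x qx hx; rewrite opprB addrC subrK; apply: cmax.
  exact/mem_set.
(* With weight d C the perturbation is at most 3/4 d, less than the gap. On q = r this gives F < f z
   = F z where h >= 0, and where h < 0 already f <= f z suffices; hence the maximum of F is
   interior. *)
pose F x := f x + d * C * h x.
have e0 : 0 < d * C by rewrite mulr_gt0.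
have [||c /set_mem /= cr cmax] := EVT_max_rV (f := F) _ (@compact_dot_le R n z r).
- by exists z; rewrite /= subrr dot0l ltW.
- apply: continuous_in_subspaceT => x /set_mem /= xr.
  have [Ux _ _] := Hr _ xr.
  apply: continuous_addr; first exact: f_cont.
  by apply: continuous_mulr; [exact: cst_continuous | exact: h_cont].
have Fc : f z <= F c.
  have -> : f z = F z.
    by rewrite /F /h sz /q subrr dot0l mul0r subr0 mulr0 addr0.
  by apply: cmax; apply/mem_set; rewrite /= subrr dot0l ltW.
have [Uc Lc _] := Hr _ cr.
have {}cr : q c < r.
  rewrite lt_neqAle cr andbT; apply/eqP => qc; move: Fc.
  rewrite leNgt => /negP; apply; rewrite /F.
  have [hc|hc] := leP 0 (h c).
    have := Hd _ qc hc; have := h_le c; rewrite qc lexx => /(_ isT).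
    rewrite ler_pdivlMr // => hC fc.
    have : d * (h c * C) <= d * (3 / 4) by rewrite ler_pM2l.
    lra.
  have := fmax c Uc; have : d * C * h c < 0 by rewrite pmulr_rlt0.
  lra.
have dsub v x : is_derive x v (fun w => w - z) v.
  by apply: is_derive_eq (subr0 v).
have ds v x : is_derive x v s (dot nu v).
  by apply: is_derive_eq (is_derive_dot (is_derive_cst nu x v) (dsub v x)) _; rewrite dot0l add0r.
have dq v x : is_derive x v q (2 * dot (x - z) v).
  apply: is_derive_eq (is_derive_dot (dsub v x) (dsub v x)) _.
  by rewrite dotC; ring.
pose dh v x := dot nu v * (1 + 2 * C * s x) - 2 * dot (x - z) v.
have dk (k0 : R) (x v : 'rV[R]_n) : is_derive x v (fun=> k0) 0 by exact: is_derive_cst.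
have hder (v x : 'rV[R]_n) : is_derive x v h (dh v x).
  have dCs := is_derive_mulr (dk C x v) (ds v x).
  have d1 := is_derive_addr (dk 1 x v) dCs.
  have dNq := is_derive_mulr (dk (- 1) x v) (dq v x).
  have := is_derive_addr (is_derive_mulr (ds v x) d1) dNq.
  rewrite (_ : (fun _ => _) = h); last by apply/funext => w; rewrite /h; ring.
  by move/is_derive_eq; apply; rewrite /dh; ring.
have dhder (v x : 'rV[R]_n) :
    is_derive x v (dh v) (2 * C * dot nu v ^+ 2 - 2 * dot v v).
  have dCs := is_derive_mulr (dk (2 * C) x v) (ds v x).
  have d1 := is_derive_addr (dk 1 x v) dCs.
  have dw := is_derive_dot (dsub v x) (is_derive_cst v x v).
  have := is_derive_addr (is_derive_mulr (dk (dot nu v) x v) d1)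
    (is_derive_mulr (dk (- 2) x v) dw).
  rewrite (_ : (fun _ => _) = dh v); last first.
    by apply/funext => w; rewrite /dh; ring.
  by move/is_derive_eq; apply; rewrite (dotC (x - z)) dot0l; ring.
have max2 (v : 'rV[R]_n) : 'D_v f c + d * C * dh v c = 0 /\
    'D_v ('D_v f) c + d * C * (2 * C * dot nu v ^+ 2 - 2 * dot v v) <= 0.
  have DF (x : 'rV[R]_n) : U x -> is_derive x v F ('D_v f x + d * C * dh v x).
    move=> Ux.
    have fx : is_derive x v f ('D_v f x).
      by apply: derivableP; apply: diff_derivable; exact: f_diff.
    have := is_derive_addr fx (is_derive_mulr (dk (d * C) x v) (hder v x)).
    by move/is_derive_eq; apply; rewrite mulr0 addr0.
  have nU : nbhs c U by exact: open_nbhs_nbhs.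
  have E1 : \forall x \near c, 'D_v f x + d * C * dh v x = 'D_v F x.
    by near=> x; have [|_ ->] := DF x; first near: x.
  have fc : is_derive c v ('D_v f) ('D_v ('D_v f) c).
      by apply: derivableP; exact: f_diff2.
  have D2F : is_derive c v ('D_v F)
      ('D_v ('D_v f) c + d * C * (2 * C * dot nu v ^+ 2 - 2 * dot v v)).
    have := is_derive_addr fc (is_derive_mulr (dk (d * C) c v) (dhder v c)).
    by rewrite mulr0 addr0 => /(near_eq_is_derive E1).
  have [|||] := @derive2_at_max _ _ F c v.
  - by near=> x; have [|] := DF x; first near: x.
  - by case: D2F.
  - have : \forall x \near c, q x < r by exact: (cvgr_lt (q c) (@q_cont c)).
    apply: filterS => x xr; apply: cmax; apply/mem_set; exact: ltW.
  - by have [_ <-] := DF c Uc; have [_ <-] := D2F.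
have sum2 : \sum_i 'D_(X i c) ('D_(X i c) f) c + d * C * (2 * C * E c - 2 * T c) <= 0.
  rewrite /E /T !mulr_sumr -sumrB mulr_sumr -big_split /=.
  by apply: sumr_le0 => i _; have [] := max2 (X i c).
(* The first derivative test along Y c trades the first order term of f for that of the barrier, so
   the subsolution inequality at c would give d C L c <= 0. *)
have [DY _] := max2 (Y c).
have := f_subsol Uc.
have : 0 < d * C * L c by rewrite mulr_gt0.
rewrite /L; move: DY; rewrite /dh; lra.
Unshelve. all: by end_near. Qed.

(** If f y were below the maximum for some y near x0, let z be a point of the maximum set nearest to
    y. The open ball about y through z avoids that set, and [hopf_touching_ball] excludes this at
    z. *)
Lemma strong_maximum_principle x0 : U x0 ->
  (forall x, U x -> f x <= f x0) -> \forall x \near x0, f x = f x0.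
Proof.
move=> Ux0 fmax.
have nU : nbhs x0 U by exact: open_nbhs_nbhs.
have [r r0 Hr] := nbhs_dot_le nU.
(* A quarter of the squared radius keeps the ball about y through z inside the ball of U: its points
   satisfy |x - x0|^2 <= 2 (|x - y|^2 + |y - x0|^2) < r. *)
have : \forall y \near x0, dot (y - x0) (y - x0) < r / 4.
  apply: (cvgr_lt _ (@continuous_dot_sub R n x0 x0)).
  by rewrite subrr dot0l divr_gt0.
apply: filterS => y yx0; apply/eqP; apply: contraT => fy.
have y_lt : f y < f x0.
  rewrite lt_neqAle fy fmax //; apply: Hr; apply: ltW; apply: lt_le_trans yx0 _.
  lra.
pose K := [set x | dot (x - x0) (x - x0) <= r] `&` [set x | f x = f x0].
have f_cont x : U x -> {for x, continuous f}.
  by move=> /f_diff; exact: differentiable_continuous.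
have cK : compact K.
  have cB := @compact_dot_le R n x0 r.
  have cfB : {within [set x | dot (x - x0) (x - x0) <= r], continuous f}.
    by apply: continuous_in_subspaceT => x /set_mem /= /Hr; exact: f_cont.
  apply: subclosed_compact cB _; last by move=> x [].
  rewrite /K closed_setSI; last exact: closed_dot_le.
  by move/continuous_closedP: cfB => /(_ _ (@closed_eq _ (f x0))).
have [||z /set_mem[/= zr fz] zmin] := EVT_min_rV (f := fun x => dot (x - y) (x - y)) _ cK.
- by exists x0; split => //=; rewrite subrr dot0l ltW.
- by apply: continuous_subspaceT; exact: continuous_dot_sub.
have yz : y != z by apply: contraTneq y_lt => ->; rewrite fz ltxx.
have zy0 : dot (z - y) (z - y) <= dot (y - x0) (y - x0).
  rewrite -[in leRHS](opprB x0) dotNl dotNr opprK; apply: zmin; apply/mem_set.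
  by split; rewrite //= subrr dot0l ltW.
case: (@hopf_touching_ball z y) => //; first exact: Hr.
  by move=> x Ux; rewrite fz fmax.
move=> x Ux xz; rewrite fz lt_neqAle fmax // andbT; apply/eqP => fx.
move: (xz); rewrite ltNge => /negP; apply; apply: zmin; apply/mem_set; split => //=.
rewrite -(subrKA y) (le_trans (dot_parallelogram _ _)) //; lra.
Qed.

End StrongMaximumPrinciple.

(** * The Laplacian of the squared norm of an immersion *)

Lemma bilin_delta (R : realType) n (G : 'M[R]_n) i j :
  bilin G (delta_mx 0 i) (delta_mx 0 j) = G i j.
Proof. by rewrite /bilin -rowE trmx_delta -colE !mxE. Qed.

Section Immersions.
Variables (R : realType) (n m : nat) (M : topologicalType).
Variables (S : smooth_manifold R n M) (g : riemannian_metric S).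
Variable phi : M -> 'rV[R]_m.
Hypothesis phi_isom : isometric_immersion g phi.

Local Notation psi := (@localrep R n m M phi).
Local Notation J := (@tangent_space R n m M phi).

Lemma localrep_differentiable c x :
  atlas S c -> ccod c x -> differentiable (psi c) x.
Proof. by case: phi_isom => -[/(_ c) + _] _ => /[apply]/(_ 1%N)[+ _]; exact. Qed.

Lemma localrep_differentiable2 c x v :
  atlas S c -> ccod c x -> differentiable ('D_v (psi c)) x.
Proof. by case: phi_isom => -[/(_ c) + _] _ => /[apply]/(_ 2%N)[_ /(_ v)[+ _]]; exact. Qed.

Lemma localrep_continuous_derive c x v :
  atlas S c -> ccod c x -> continuous_at x ('D_v (psi c)).
Proof. by move=> cS /(localrep_differentiable2 v cS); exact: differentiable_continuous. Qed.

Lemma localrep_continuous_derive2 c x u v :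
  atlas S c -> ccod c x -> continuous_at x ('D_u ('D_v (psi c))).
Proof.
case: phi_isom => -[/(_ c) + _] _ => /[apply]/(_ 2%N)[_ /(_ v)[_ /(_ u)]] cD xc.
by apply: cD; exact: mem_set.
Qed.

Lemma derive_localrep c x v :
  atlas S c -> ccod c x -> 'D_v (psi c) x = v *m J c x.
Proof. by move=> cS xc; apply: deriveEjacobian; exact: localrep_differentiable. Qed.

Lemma metric_gram c x : atlas S c -> ccod c x -> g c x = J c x *m (J c x)^T.
Proof.
move=> cS xc; case: phi_isom => _ isom; apply/matrixP => i j.
rewrite -bilin_delta isom // /dot -!mul_rV_lin1 -/(J c x) trmx_mul mulmxA.
by rewrite -(mulmxA _ (J c x)) -[LHS]/(bilin _ _ _) bilin_delta.
Qed.

Lemma metric_unit c x : atlas S c -> ccod c x -> g c x \in unitmx.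
Proof.
move=> cS xc; rewrite -row_free_unit; apply: inj_row_free => v vg.
apply/eqP; apply: contraT => /(metric_pos g cS xc).
by rewrite /bilin vg mul0mx mxE ltxx.
Qed.

(* In a chart, the Laplacian of M is sum_k D_(X_k) D_(X_k) - D_(drift), with X_k
   the k-th row of [frame] frozen at the point: sum_k X_k^i X_k^j = g^ij.
   Writing g^ij as a sum of squares turns the sign of the Laplacian at an
   extremum into m second derivative tests along lines. *)
Definition frame c x : 'M[R]_(m, n) := (J c x)^T *m invmx (g c x).

Lemma invmx_metric_sym c x : atlas S c -> ccod c x ->
  (invmx (g c x))^T = invmx (g c x).
Proof. by move=> cS xc; rewrite trmx_inv Defs.metric_sym. Qed.

Lemma frame_gram c x : atlas S c -> ccod c x ->
  (frame c x)^T *m frame c x = invmx (g c x).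
Proof.
move=> cS xc; rewrite /frame trmx_mul trmxK invmx_metric_sym //.
by rewrite !mulmxA -(mulmxA _ (J c x)) -metric_gram // mulVmx ?mul1mx ?metric_unit.
Qed.

(* The sum is the trace of J^T g^-1 J, the orthogonal projection onto the
   tangent space. *)
Lemma sum_dot_frame c x : atlas S c -> ccod c x ->
  \sum_k dot (row k (frame c x) *m J c x) (row k (frame c x) *m J c x) = n%:R.
Proof.
move=> cS xc; under eq_bigr do rewrite -row_mul.
rewrite dot_row_mul_tr trmx_mul mxtrace_mulC -mulmxA (mulmxA (frame c x)^T).
rewrite frame_gram // mulmxA mxtrace_mulC mulmxA -metric_gram //.
by rewrite mulmxV ?metric_unit // mxtrace1.
Qed.

(** A vector orthogonal to all rows is killed by [frame], hence by its Gram matrix, the invertible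
    g^-1. *)
Lemma frame_elliptic c x u : atlas S c -> ccod c x ->
  (forall k, dot u (row k (frame c x)) = 0) -> u = 0.
Proof.
move=> cS xc u0; have Pu : frame c x *m u^T = 0.
  apply/row_matrixP => k; rewrite row_mul row0; apply/rowP => j.
  by rewrite ord1 -[LHS]/(dot _ _) dotC u0 mxE.
apply: trmx_inj; rewrite trmx0 -[LHS](mulKVmx (metric_unit cS xc)).
by rewrite -frame_gram // -mulmxA Pu !mulmx0.
Qed.

Definition trace_hessian c x := metric_trace g c x (fun u v => 'D_u ('D_v (psi c)) x).

Lemma derive2_localrep c x u v : atlas S c -> ccod c x ->
  'D_u ('D_v (psi c)) x = \sum_i \sum_j (u 0 i * v 0 j) *:
    'D_(delta_mx 0 i) ('D_(delta_mx 0 j) (psi c)) x.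
Proof.
move=> cS xc.
have Dv : \forall y \near x,
    'D_v (psi c) y = \sum_j v 0 j *: 'D_(delta_mx 0 j) (psi c) y.
  have : nbhs x (ccod c) by apply: open_nbhs_nbhs; split=> //; exact: ccod_open.
  apply: filterS => y yc; rewrite derive_localrep // {1}[v]row_sum_delta mulmx_suml.
  by apply: eq_bigr => j _; rewrite derive_localrep // scalemxAl.
have d2 w := localrep_differentiable2 w cS xc.
rewrite (near_eq_derive _ Dv).
rewrite (_ : (fun _ => _) = \sum_j (v 0 j *: 'D_(delta_mx 0 j) (psi c))); last first.
  by apply/funext => y; rewrite fct_sumE.
rewrite derive_sum => [|j]; last by apply: derivableZ; exact: diff_derivable.
rewrite exchange_big; apply: eq_bigr => j _.
rewrite deriveZ; last exact: diff_derivable.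
rewrite deriveE // {1}[u]row_sum_delta linear_sum scaler_sumr.
by apply: eq_bigr => i _; rewrite linearZ /= -deriveE // scalerA mulrC.
Qed.

Lemma sum_derive2_frame c x : atlas S c -> ccod c x ->
  \sum_k 'D_(row k (frame c x)) ('D_(row k (frame c x)) (psi c)) x =
  trace_hessian c x.
Proof.
move=> cS xc; under eq_bigr do rewrite derive2_localrep //.
rewrite exchange_big; apply: eq_bigr => i _.
rewrite exchange_big; apply: eq_bigr => j _ /=.
rewrite -scaler_suml -(frame_gram cS xc) mxE; congr (_ *: _).
by apply: eq_bigr => k _; rewrite !mxE.
Qed.

(** Projections thus leave the trace, so the mean curvatures in R^m and in the sphere are both
    obtained by projecting [trace_hessian]. *)
Lemma metric_trace_linear c x (P : {linear 'rV[R]_m -> 'rV[R]_m}) B :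
  metric_trace g c x (fun u v => P (B u v)) = P (metric_trace g c x B).
Proof.
rewrite /metric_trace linear_sum; apply: eq_bigr => i _.
by rewrite linear_sum; apply: eq_bigr => j _; rewrite linearZ.
Qed.

Lemma mean_curvature_trace c x :
  mean_curvature g phi c x = normal_part phi c x (trace_hessian c x).
Proof. exact: metric_trace_linear. Qed.

Lemma sphere_mean_curvature_trace c x :
  sphere_mean_curvature g phi c x =
  normal_part phi c x (orth_proj (orthc (psi c x)) (trace_hessian c x)).
Proof. by rewrite /trace_hessian -metric_trace_linear; exact: metric_trace_linear. Qed.

(** In classical notation its k-th component is g^ij Gamma_ij^k: the tangential part of the
    coordinate second derivatives encodes the Levi-Civita connection of M. *)
Definition drift c x : 'rV[R]_n :=
  trace_hessian c x *m (J c x)^T *m invmx (g c x).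

Lemma normal_part_orth c x w : normal_part phi c x w *m (J c x)^T = 0.
Proof. by apply/eqP; rewrite -sub_orthc orth_proj_sub. Qed.

(** The difference is tangent, hence of the form d J. Multiplying by J^T kills the normal part and
    leaves d J J^T = d g, which determines d. *)
Lemma tangent_trace_hessian c x : atlas S c -> ccod c x ->
  trace_hessian c x - mean_curvature g phi c x = drift c x *m J c x.
Proof.
move=> cS xc; rewrite mean_curvature_trace; set V := trace_hessian c x.
have /submxP[d dE] : (V - normal_part phi c x V <= J c x)%MS.
  by rewrite -(orthcK (J c x)) sub_orth_proj.
rewrite dE; congr (_ *m _).
have : V *m (J c x)^T = d *m g c x.
  rewrite metric_gram // mulmxA -dE mulmxBl normal_part_orth subr0 //.
by rewrite /drift => ->; rewrite mulmxK ?metric_unit.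
Qed.

Definition sqnorm c y := dot (psi c y) (psi c y).

Lemma is_derive_sqnorm c x v : atlas S c -> ccod c x ->
  is_derive x v (sqnorm c) (2 * dot ('D_v (psi c) x) (psi c x)).
Proof.
move=> cS xc; have d := derivableP (diff_derivable (v := v) (localrep_differentiable cS xc)).
by apply: is_derive_eq (is_derive_dot d d) _; rewrite [dot (psi c x) _]dotC; ring.
Qed.

Lemma is_derive2_sqnorm c x v : atlas S c -> ccod c x ->
  is_derive x v ('D_v (sqnorm c))
    (2 * (dot ('D_v ('D_v (psi c)) x) (psi c x) + dot (v *m J c x) (v *m J c x))).
Proof.
move=> cS xc.
have d1 := derivableP (diff_derivable (v := v) (localrep_differentiable cS xc)).
have d2 := derivableP (diff_derivable (v := v) (localrep_differentiable2 v cS xc)).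
have near_derive : \forall y \near x,
    2 * dot ('D_v (psi c) y) (psi c y) = 'D_v (sqnorm c) y.
  have : nbhs x (ccod c) by apply: open_nbhs_nbhs; split=> //; exact: ccod_open.
  by apply: filterS => y yc; have [_ ->] := is_derive_sqnorm v cS yc.
have := is_derive_mulr (is_derive_cst (2 : R) x v) (is_derive_dot d2 d1).
move/(near_eq_is_derive near_derive)/is_derive_eq; apply.
by rewrite /cst mulr0 addr0 derive_localrep.
Qed.

(** The product rule gives 2 (<V, psi> + n) with V the [trace_hessian], and n arising as the trace
    of the tangent projection. Splitting V into H and its tangent part turns the latter into the
    derivative along the drift. *)
Lemma laplacian_sqnorm c x : atlas S c -> ccod c x ->
  \sum_k 'D_(row k (frame c x)) ('D_(row k (frame c x)) (sqnorm c)) x =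
  'D_(drift c x) (sqnorm c) x + 2 * (n%:R + dot (mean_curvature g phi c x) (psi c x)).
Proof.
move=> cS xc.
transitivity (2 * (dot (trace_hessian c x) (psi c x) + n%:R)).
  rewrite -(sum_dot_frame cS xc) -(sum_derive2_frame cS xc) dot_suml -big_split.
  rewrite mulr_sumr; apply: eq_bigr => k _.
  by have [_ ->] := is_derive2_sqnorm (row k (frame c x)) cS xc.
have [_ ->] := is_derive_sqnorm (drift c x) cS xc.
rewrite derive_localrep // -tangent_trace_hessian // dotDl dotNl; ring.
Qed.

Lemma continuous_tangent_space c x : atlas S c -> ccod c x -> continuous_at x (J c).
Proof.
move=> cS xc; apply/continuous_mxP => i j.
have DJ : \forall y \near x, 'D_(delta_mx 0 i) (psi c) y 0 j = J c y i j.
  have : nbhs x (ccod c) by apply: open_nbhs_nbhs; split=> //; exact: ccod_open.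
  by apply: filterS => y yc; rewrite derive_localrep // -rowE [LHS]mxE.
apply: (near_eq_continuous_at DJ).
by have /continuous_mxP := @localrep_continuous_derive c x (delta_mx 0 i) cS xc.
Qed.

Lemma continuous_metric c x : atlas S c -> ccod c x -> continuous_at x (g c).
Proof. by move=> cS xc; apply: (metric_smooth g cS 0%N); exact: mem_set. Qed.

Lemma continuous_invmx_metric c x : atlas S c -> ccod c x ->
  continuous_at x (fun y => invmx (g c y)).
Proof.
by move=> cS xc; apply: continuous_invmx; [exact: metric_unit | exact: continuous_metric].
Qed.

Lemma continuous_frame c x : atlas S c -> ccod c x -> continuous_at x (frame c).
Proof.
move=> cS xc; apply: continuous_mulmx; last exact: continuous_invmx_metric.
by apply: continuous_trmx; exact: continuous_tangent_space.
Qed.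

Lemma continuous_drift c x : atlas S c -> ccod c x -> continuous_at x (drift c).
Proof.
move=> cS xc; apply: continuous_mulmx; last exact: continuous_invmx_metric.
apply: continuous_mulmx; last by apply: continuous_trmx; exact: continuous_tangent_space.
apply/continuous_mxP => k l.
rewrite (_ : (fun _ => _) = fun y => \sum_i \sum_j
  (invmx (g c y)) i j * ('D_(delta_mx 0 i) ('D_(delta_mx 0 j) (psi c)) y) k l).
  apply: continuous_sumr => i; apply: continuous_sumr => j; apply: continuous_mulr.
    by have /continuous_mxP := continuous_invmx_metric cS xc.
  by have /continuous_mxP := @localrep_continuous_derive2 c x (delta_mx 0 i) (delta_mx 0 j) cS xc.
apply/funext => y; rewrite /trace_hessian /metric_trace summxE.
by apply: eq_bigr => i _; rewrite summxE; apply: eq_bigr => j _; rewrite mxE.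
Qed.

End Immersions.

(** * Solitons *)

Section Solitons.
Variables (R : realType) (n m : nat) (M : topologicalType).
Variables (S : smooth_manifold R n M) (g : riemannian_metric S).
Variables (phi : M -> 'rV[R]_m) (a : R).
Hypothesis phi_soliton : imcf_soliton g phi a.

Local Notation psi := (@localrep R n m M phi).
Local Notation H := (mean_curvature g phi).

Let phi_isom : isometric_immersion g phi. Proof. by case: phi_soliton. Qed.
Let a_neq0 : a != 0. Proof. by case: phi_soliton. Qed.

(** H is normal, so it sees only the normal part of psi; pairing the soliton equation with H then
    cancels |H|^2. *)
Lemma dot_mean_curvature c x : atlas S c -> ccod c x ->
  dot (H c x) (psi c x) = - a^-1.
Proof.
move=> cS xc; case: phi_soliton => _ _ /(_ c x cS xc) H0 /(_ c x cS xc) soliton.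
apply: (mulfI a_neq0); rewrite mulrN divff //.
have -> : dot (H c x) (psi c x) = dot (H c x) (normal_part phi c x (psi c x)).
  by rewrite -dot_orth_proj mean_curvature_trace orth_proj_id ?orth_proj_sub.
rewrite -dotZr -soliton dotNr dotZr sqr_enorm mulVf ?dot_eq0 //.
Qed.

Lemma laplacian_sqnorm_soliton c x : atlas S c -> ccod c x ->
  \sum_k 'D_(row k (frame g phi c x)) ('D_(row k (frame g phi c x)) (sqnorm phi c)) x =
  'D_(drift g phi c x) (sqnorm phi c) x + 2 * (n%:R - a^-1).
Proof. by move=> cS xc; rewrite laplacian_sqnorm // dot_mean_curvature. Qed.

Lemma continuous_immersion : continuous phi.
Proof.
move=> p; have [c cS pc] := atlas_cover S p.
have near_c : \forall q \near p, psi c (cfwd c q) = phi q.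
  have : nbhs p (cdom c) by apply: open_nbhs_nbhs; split=> //; exact: cdom_open.
  by apply: filterS => q qc; rewrite /localrep /= cfwdK.
apply: (near_eq_continuous_at near_c).
have /differentiable_continuous psi_cont :=
  localrep_differentiable phi_isom cS (cfwd_cod pc).
apply: continuous_comp psi_cont.
by apply: cfwd_continuous; exact: mem_set.
Qed.

Let F p := dot (phi p) (phi p).

Lemma continuous_sqnorm_immersion : continuous F.
Proof. by move=> p; apply: continuous_dot; exact: continuous_immersion. Qed.

Lemma sqnorm_cfwd (c : chart R n M) p : cdom c p -> sqnorm phi c (cfwd c p) = F p.
Proof. by move=> pc; rewrite /sqnorm /localrep /= cfwdK. Qed.

Let near_derivable_sqnorm c x v : atlas S c -> ccod c x ->
  \forall y \near x, derivable (sqnorm phi c) y v.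
Proof.
move=> cS xc; have : nbhs x (ccod c) by apply: open_nbhs_nbhs; split=> //; exact: ccod_open.
by apply: filterS => y yc; have [] := is_derive_sqnorm phi_isom v cS yc.
Qed.

Lemma soliton_velocity : [set: M] !=set0 -> compact [set: M] -> a = n%:R^-1.
Proof.
move=> M0 Mc; suff : n%:R = a^-1 by move=> ->; rewrite invrK.
have F_cont : {within [set: M], continuous F}.
  by apply: continuous_subspaceT; exact: continuous_sqnorm_immersion.
have [p _ pmax] := compact_EVT_max M0 Mc F_cont.
have [q _ qmin] := compact_EVT_min M0 Mc F_cont.
apply: le_anti; apply/andP; split.
- have [c cS pc] := atlas_cover S p; have xc := cfwd_cod pc; set x := cfwd c p in xc.
  have test v : 'D_v (sqnorm phi c) x = 0 /\ 'D_v ('D_v (sqnorm phi c)) x <= 0.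
    apply: derive2_at_max; first exact: near_derivable_sqnorm.
      by have [] := is_derive2_sqnorm phi_isom v cS xc.
    by near=> y; rewrite sqnorm_cfwd //; apply: pmax; exact: mem_set.
  have := laplacian_sqnorm_soliton cS xc; rewrite (test _).1 add0r => E.
  have : \sum_k 'D_(row k (frame g phi c x)) ('D_(row k (frame g phi c x)) (sqnorm phi c)) x <= 0.
    by apply: sumr_le0 => k _; exact: (test _).2.
  by rewrite E; lra.
- have [c cS qc] := atlas_cover S q; have xc := cfwd_cod qc; set x := cfwd c q in xc.
  have test v : 'D_v (sqnorm phi c) x = 0 /\ 0 <= 'D_v ('D_v (sqnorm phi c)) x.
    apply: derive2_at_min; first exact: near_derivable_sqnorm.
      by have [] := is_derive2_sqnorm phi_isom v cS xc.
    by near=> y; rewrite sqnorm_cfwd //; apply: qmin; exact: mem_set.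
  have := laplacian_sqnorm_soliton cS xc; rewrite (test _).1 add0r => E.
  have : 0 <= \sum_k 'D_(row k (frame g phi c x)) ('D_(row k (frame g phi c x)) (sqnorm phi c)) x.
    by apply: sumr_ge0 => k _; exact: (test _).2.
  by rewrite E; lra.
Unshelve. all: by end_near. Qed.

(** The set where F attains its maximum is nonempty by compactness, closed by continuity, and open
    by the strong maximum principle in a chart around each of its points. *)
Lemma soliton_sqnorm_cst : [set: M] !=set0 -> connected [set: M] -> compact [set: M] ->
  exists r, forall p, F p = r.
Proof.
move=> M0 Mconn Mc.
have [p _ pmax] : exists2 p, p \in [set: M] & forall t, t \in [set: M] -> F t <= F p.
  apply: compact_EVT_max => //.
  by apply: continuous_subspaceT; exact: continuous_sqnorm_immersion.
exists (F p) => q; pose K := [set q | F q = F p].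
suff : K = [set: M] by move=> KT; have : K q by rewrite KT.
apply: Mconn; first by exists p.
- exists K; last by rewrite setTI.
  rewrite openE => {}q Kq; have [c cS qc] := atlas_cover S q.
  have xc := cfwd_cod qc.
  have : \forall y \near cfwd c q, sqnorm phi c y = sqnorm phi c (cfwd c q).
    apply: (@strong_maximum_principle R n m (ccod c) (sqnorm phi c)
      (fun k y => row k (frame g phi c y)) (drift g phi c)) => //.
    + exact: ccod_open.
    + move=> y yc; have dpsi := localrep_differentiable phi_isom cS yc.
      exact: (differentiable_dot dpsi dpsi).
    + by move=> y v yc; have [] := is_derive2_sqnorm phi_isom v cS yc.
    + by move=> k y yc; apply: continuous_row; exact: continuous_frame.
    + by move=> y yc; exact: continuous_drift.
    + by move=> y u yc; exact: frame_elliptic.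
    + move=> y yc; rewrite laplacian_sqnorm_soliton // soliton_velocity //.
      by rewrite invrK subrr mulr0 addr0.
    + by move=> y _; rewrite sqnorm_cfwd // Kq; apply: pmax; exact: mem_set.
  rewrite sqnorm_cfwd // Kq => const.
  have fwd : cfwd c q' @[q' --> q] --> cfwd c q by apply: cfwd_continuous; exact: mem_set.
  have nc : nbhs q (cdom c) by apply: open_nbhs_nbhs; split=> //; exact: cdom_open.
  have nF : \forall q' \near q, sqnorm phi c (cfwd c q') = F p := fwd _ const.
  by apply: filterS2 nc nF => q' q'c; rewrite sqnorm_cfwd.
- exists K; last by rewrite setTI.
  apply: (@preimage_closed _ _ F [set t | t = F p]); last exact: closed_eq.
  by move=> t _; exact: continuous_sqnorm_immersion.
Qed.

Lemma soliton_minimal_in_sphere s : 0 < s -> (forall p, F p = s) ->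
  minimal_in_sphere g phi (Num.sqrt s).
Proof.
move=> s0 Fs; split=> // [p|c x cS xc]; first by rewrite /sphere /= /enorm -/(F p) Fs.
have psis : sqnorm phi c = cst s by apply/funext => y; exact: Fs.
(* Differentiating the constant |psi|^2 along each coordinate direction makes psi orthogonal to the
   rows of J. *)
have normal : normal_part phi c x (psi c x) = psi c x.
  apply: orth_proj_id; rewrite sub_orthc; apply/eqP/rowP => i; rewrite [RHS]mxE.
  have [_] := is_derive_sqnorm phi_isom (delta_mx 0 i) cS xc.
  rewrite psis derive_cst (derive_localrep phi_isom) // dot_mulmxl dot_delta.
  by move/esym/eqP; rewrite mulf_eq0 pnatr_eq0 => /eqP.
rewrite sphere_mean_curvature_trace //.
set V := trace_hessian g phi c x; set QV := orth_proj _ V.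
have [l HE] : exists l, H c x = l *: psi c x.
  case: phi_soliton => _ _ /(_ c x cS xc) H0 /(_ c x cS xc).
  rewrite normal => soliton; exists (- (enorm (H c x) ^+ 2 * a)).
  rewrite scaleNr -scalerA -soliton scalerN opprK scalerA divff ?scale1r //.
  by rewrite sqr_enorm dot_eq0.
have [t tE] : exists t, V - QV = t *: psi c x.
  by apply/sub_rVP; rewrite -(orthcK (psi c x)) sub_orth_proj.
(* QV differs from V by a multiple of psi, and the normal part H of V is another one, so the normal
   part of QV is a multiple of psi. By self-adjointness its product with psi is <QV, psi> = 0, and
   |psi|^2 = s is nonzero. *)
have WE : normal_part phi c x QV = (l - t) *: psi c x.
  rewrite -[QV](subKr V) tE scalerBl -HE mean_curvature_trace -/V -[in RHS]normal.
  by rewrite /normal_part linearB linearZ.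
have : dot (normal_part phi c x QV) (psi c x) = 0.
  rewrite dot_orth_proj -/(normal_part phi c x _) normal.
  by have := orth_proj_sub (orthc (psi c x)) V; rewrite sub_orthc /dot => /eqP->; rewrite mxE.
rewrite WE dotZl -/(sqnorm phi c x) psis => /eqP.
by rewrite mulf_eq0 (gt_eqF s0) orbF => /eqP->; rewrite scale0r.
Qed.

End Solitons.

Theorem theorem2p1 (R : realType) (n m : nat) (M : topologicalType)
    (S : smooth_manifold R n M) (g : riemannian_metric S)
    (phi : M -> 'rV[R]_m) (a : R)
    (M_nonempty : [set: M] !=set0)
    (M_connected : connected [set: M])
    (M_closed : compact [set: M])
    (phi_soliton : imcf_soliton g phi a) :
  [/\ a = n%:R^-1,
      imcf_expander g phi a
    & exists2 r : R, 0 < r & minimal_in_sphere g phi r].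
Proof.
have aE := soliton_velocity phi_soliton M_nonempty M_closed.
have a0 : a != 0 by case: phi_soliton.
have [s Fs] := soliton_sqnorm_cst phi_soliton M_nonempty M_connected M_closed.
(* The radius is not zero: phi p = 0 would contradict <H, phi> = - 1/a. *)
have s0 : 0 < s.
  have [p _] := M_nonempty; have [c cS pc] := atlas_cover S p.
  rewrite -(Fs p) dot_gt0; apply: contra_neq a0 => phi0.
  have := dot_mean_curvature phi_soliton cS (cfwd_cod pc).
  rewrite /localrep /= cfwdK // phi0 dotC dot0l => /esym/eqP.
  by rewrite oppr_eq0 invr_eq0 => /eqP.
(* As an inverse of a natural number a is nonnegative; [a0] also rules out n = 0, for which
   [n%:R^-1] is 0. *)
split=> //; first by split=> //; rewrite lt_def a0 aE invr_ge0 ler0n.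
exists (Num.sqrt s); first by rewrite sqrtr_gt0.
exact: (soliton_minimal_in_sphere phi_soliton s0 Fs).
Qed.
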